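(* Let $x_1,x_2,y_1,y_2,u_1,u_2,v_1,v_2,p_{+1},p_{+2},p_{-1},p_{-2},q_{+1},q_{+2},q_{-1},q_{-2},s,\lambda$ and $\mathbf{w}=(w_\ell)_{\ell\ge0}$ be commuting indeterminates, and for $n\ge0$ let \[ \widehat{Q}_n=\sum_{\sigma\in\mathfrak{S}_n} x_1^{\mathrm{eareccpeak}}x_2^{\mathrm{eareccdfall}}y_1^{\mathrm{ereccval}}y_2^{\mathrm{ereccdrise}}u_1^{\mathrm{nrcpeak}}u_2^{\mathrm{nrcdfall}}v_1^{\mathrm{nrcval}}v_2^{\mathrm{nrcdrise}}\Big(\prod_{i\in\mathrm{Fix}(\sigma)}w_{\mathrm{psnest}(i,\sigma)}\Big) p_{+1}^{\mathrm{ucrosscval}}p_{+2}^{\mathrm{ucrosscdrise}}p_{-1}^{\mathrm{lcrosscpeak}}p_{-2}^{\mathrm{lcrosscdfall}}q_{+1}^{\mathrm{unestcval}}q_{+2}^{\mathrm{unestcdrise}}q_{-1}^{\mathrm{lnestcpeak}}q_{-2}^{\mathrm{lnestcdfall}}s^{\mathrm{psnest}}\lambda^{\mathrm{cyc}}, \] all statistics evaluated at $\sigma$. Under the specialisation $v_1=y_1$ and $q_{+1}=p_{+1}$, the ordinary generating function $\sum_{n\ge0}\widehat{Q}_n t^n$ equals the J-fraction \[ \cfrac{1}{1-\gamma_0t-\cfrac{\beta_1t^2}{1-\gamma_1t-\cfrac{\beta_2t^2}{1-\cdots}}} \] with $\gamma_0=\lambda w_0$, $\gamma_n=\big(p_{-2}^{n-1}x_2+q_{-2}[n-1]_{p_{-2},q_{-2}}u_2\big)+\big(p_{+2}^{n-1}y_2+q_{+2}[n-1]_{p_{+2},q_{+2}}v_2\big)+\lambda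 s^nw_n$ for $n\ge1$, and $\beta_n=(\lambda+n-1)\big(p_{-1}^{n-1}x_1+q_{-1}[n-1]_{p_{-1},q_{-1}}u_1\big)p_{+1}^{n-1}y_1$ for $n\ge1$.
   Context: $\mathfrak{S}_n$ is the set of permutations of $[n]$. For $\sigma\in\mathfrak{S}_n$, an index $i$ is a cycle peak if $\sigma^{-1}(i)<i>\sigma(i)$, cycle valley if $\sigma^{-1}(i)>i<\sigma(i)$, cycle double rise if $\sigma^{-1}(i)<i<\sigma(i)$, cycle double fall if $\sigma^{-1}(i)>i>\sigma(i)$, fixed point if $\sigma(i)=i$ ($\mathrm{Fix}(\sigma)$ = set of fixed points). Index $i$ is a record if $\sigma(j)<\sigma(i)$ for all $j<i$, an antirecord if $\sigma(j)>\sigma(i)$ for all $j>i$; exclusive record = record and not antirecord; exclusive antirecord = antirecord and not record. $\mathrm{eareccpeak}$, $\mathrm{eareccdfall}$ count cycle peaks, cycle double falls that are exclusive antirecords; $\mathrm{ereccval}$, $\mathrm{ereccdrise}$ count cycle valleys, cycle double rises that are exclusive records; $\mathrm{nrcpeak},\mathrm{nrcdfall},\mathrm{nrcval},\mathrm{nrcdrise}$ count cycle peaks, double falls, valleys, double rises that are neither records nor antirecords. $\mathrm{psnest}(i,\sigma)=\#\{j<i:\sigma(j)>i\}$ and $\mathrm{psnest}(\sigma)=\sum_{i\in\mathrm{Fix}(\sigma)}\mathrm{psnest}(i,\sigma)$. $\mathrm{cyc}(\sigma)$ = number of cycles. Index-refined statistics: $\mathrm{ucross}(j,\sigma)=\#\{(i,k,l):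 i<j<k<l,\ k=\sigma(i),\ l=\sigma(j)\}$, $\mathrm{unest}(j,\sigma)=\#\{(i,k,l):i<j<k<l,\ k=\sigma(j),\ l=\sigma(i)\}$, $\mathrm{lcross}(k,\sigma)=\#\{(i,j,l):i<j<k<l,\ i=\sigma(k),\ j=\sigma(l)\}$, $\mathrm{lnest}(k,\sigma)=\#\{(i,j,l):i<j<k<l,\ i=\sigma(l),\ j=\sigma(k)\}$. Then $\mathrm{ucrosscval}(\sigma)=\sum_{j\text{ cycle valley}}\mathrm{ucross}(j,\sigma)$, $\mathrm{ucrosscdrise}(\sigma)=\sum_{j\text{ cycle double rise}}\mathrm{ucross}(j,\sigma)$, $\mathrm{unestcval},\mathrm{unestcdrise}$ analogously with $\mathrm{unest}$; $\mathrm{lcrosscpeak}(\sigma)=\sum_{k\text{ cycle peak}}\mathrm{lcross}(k,\sigma)$, $\mathrm{lcrosscdfall}(\sigma)=\sum_{k\text{ cycle double fall}}\mathrm{lcross}(k,\sigma)$, and $\mathrm{lnestcpeak},\mathrm{lnestcdfall}$ analogously with $\mathrm{lnest}$. $[m]_{p,q}=\sum_{j=0}^{m-1}p^{m-1-j}q^j$. *)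

(* Defs.v *)
From mathcomp Require Import all_boot all_order all_fingroup all_algebra.

Set Implicit Arguments.
Unset Strict Implicit.
Unset Printing Implicit Defensive.

Import GRing.Theory.

(* [n] is represented by 'I_n = {0, ..., n-1}: every statistic below depends  *)
(* only on the relative order of indices, so the shift by one is immaterial.  *)

Section PermutationStatistics.

Variable n : nat.
Implicit Types (s : 'S_n) (i j k l : 'I_n).

Local Open Scope nat_scope.

Definition cpeak s i := (s^-1%g i < i) && (s i < i).
Definition cval s i := (i < s^-1%g i) && (i < s i).
Definition cdrise s i := (s^-1%g i < i) && (i < s i).
Definition cdfall s i := (i < s^-1%g i) && (s i < i).

Definition record s i := [forall j : 'I_n, (j < i) ==> (s j < s i)].
Definition antirecord s i := [forall j : 'I_n, (i < j) ==> (s i < s j)].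
Definition exclusive_record s i := record s i && ~~ antirecord s i.
Definition exclusive_antirecord s i := antirecord s i && ~~ record s i.
Definition neither_record s i := ~~ record s i && ~~ antirecord s i.

Definition eareccpeak s := #|[set i | cpeak s i & exclusive_antirecord s i]|.
Definition eareccdfall s := #|[set i | cdfall s i & exclusive_antirecord s i]|.
Definition ereccval s := #|[set i | cval s i & exclusive_record s i]|.
Definition ereccdrise s := #|[set i | cdrise s i & exclusive_record s i]|.
Definition nrcpeak s := #|[set i | cpeak s i & neither_record s i]|.
Definition nrcdfall s := #|[set i | cdfall s i & neither_record s i]|.
Definition nrcval s := #|[set i | cval s i & neither_record s i]|.
Definition nrcdrise s := #|[set i | cdrise s i & neither_record s i]|.

Definition Fix s := [set i | s i == i].
Definition psnest_at i s := #|[set j : 'I_n | (j < i) && (i < s j)]|.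
Definition psnest s := \sum_(i in Fix s) psnest_at i s.

Definition cyc s := #|porbits s|.

Definition ucross j s :=
  #|[set t : 'I_n * 'I_n * 'I_n | let: (i, k, l) := t in
      [&& i < j, j < k, k < l, k == s i & l == s j]]|.
Definition unest j s :=
  #|[set t : 'I_n * 'I_n * 'I_n | let: (i, k, l) := t in
      [&& i < j, j < k, k < l, k == s j & l == s i]]|.
Definition lcross k s :=
  #|[set t : 'I_n * 'I_n * 'I_n | let: (i, j, l) := t in
      [&& i < j, j < k, k < l, i == s k & j == s l]]|.
Definition lnest k s :=
  #|[set t : 'I_n * 'I_n * 'I_n | let: (i, j, l) := t in
      [&& i < j, j < k, k < l, i == s l & j == s k]]|.

Definition ucrosscval s := \sum_(j | cval s j) ucross j s.
Definition ucrosscdrise s := \sum_(j | cdrise s j) ucross j s.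
Definition unestcval s := \sum_(j | cval s j) unest j s.
Definition unestcdrise s := \sum_(j | cdrise s j) unest j s.
Definition lcrosscpeak s := \sum_(k | cpeak s k) lcross k s.
Definition lcrosscdfall s := \sum_(k | cdfall s k) lcross k s.
Definition lnestcpeak s := \sum_(k | cpeak s k) lnest k s.
Definition lnestcdfall s := \sum_(k | cdfall s k) lnest k s.

End PermutationStatistics.

Local Open Scope ring_scope.

(* pp1, pm1, qp1, qm1, ... stand for p_{+1}, p_{-1}, q_{+1}, q_{-1}, ...       *)
Definition Qhat (R : comNzRingType) (x1 x2 y1 y2 u1 u2 v1 v2 : R)
    (pp1 pp2 pm1 pm2 qp1 qp2 qm1 qm2 : R) (s lambda : R) (w : nat -> R)
    (n : nat) : R :=
  \sum_(sigma : 'S_n)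
     x1 ^+ eareccpeak sigma * x2 ^+ eareccdfall sigma
   * y1 ^+ ereccval sigma * y2 ^+ ereccdrise sigma
   * u1 ^+ nrcpeak sigma * u2 ^+ nrcdfall sigma
   * v1 ^+ nrcval sigma * v2 ^+ nrcdrise sigma
   * (\prod_(i in Fix sigma) w (psnest_at i sigma))
   * pp1 ^+ ucrosscval sigma * pp2 ^+ ucrosscdrise sigma
   * pm1 ^+ lcrosscpeak sigma * pm2 ^+ lcrosscdfall sigma
   * qp1 ^+ unestcval sigma * qp2 ^+ unestcdrise sigma
   * qm1 ^+ lnestcpeak sigma * qm2 ^+ lnestcdfall sigma
   * s ^+ psnest sigma * lambda ^+ cyc sigma.

(* [m]_{p,q} *)
Definition pqint (R : comNzRingType) (p q : R) (m : nat) : R :=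
  \sum_(j < m) p ^+ (m.-1 - j) * q ^+ j.

(* The formal power series sum_n (f n) t^n. *)
Definition fps (R : comNzRingType) := nat -> R.

Section JFraction.

Variable R : comNzRingType.

(* The coefficients of t^0, ..., t^(n-1) in 1/f, when f has constant term 1,  *)
(* obtained by solving f * (1/f) = 1 degree by degree; see fps_invP.          *)
Fixpoint inv_coefs (f : fps R) (n : nat) : seq R :=
  if n is m.+1 then
    let s := inv_coefs f m in
    rcons s ((m == 0%N)%:R - \sum_(i < m) s`_i * f (m - i)%N)
  else [::].

Definition fps_inv (f : fps R) : fps R := fun n => (inv_coefs f n.+1)`_n.

Lemma size_inv_coefs (f : fps R) n : size (inv_coefs f n) = n.
Proof. by elim: n => //= n IHn; rewrite size_rcons IHn. Qed.

Lemma nth_inv_coefs (f : fps R) n i :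
  (i < n)%N -> (inv_coefs f n)`_i = fps_inv f i.
Proof.
elim: n => // n IHn; rewrite ltnS leq_eqVlt => /orP[/eqP-> // | lt_in].
by rewrite /= nth_rcons size_inv_coefs lt_in IHn.
Qed.

Lemma fps_invP (f : fps R) (n : nat) :
  f 0%N = 1 -> \sum_(i < n.+1) fps_inv f i * f (n - i)%N = (n == 0%N)%:R.
Proof.
move=> f0; rewrite big_ord_recr /= subnn f0 mulr1.
rewrite {2}/fps_inv /= nth_rcons size_inv_coefs ltnn eqxx.
rewrite addrC (eq_bigr (fun i : 'I_n => fps_inv f i * f (n - i)%N)) ?subrK //.
by move=> i _; rewrite nth_inv_coefs.
Qed.

(* 1 - c t - b t^2 g *)
Definition jdenom (c b : R) (g : fps R) : fps R := fun n =>
  match n with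
  | 0 => 1
  | 1 => - c
  | m.+2 => - (b * g m)
  end.

(* The continued fraction starting at level k, cut after d levels:            *)
(*   1 / (1 - gamma_k t - beta_(k+1) t^2 /                                    *)
(*     (... beta_(k+d-1) t^2 / (1 - gamma_(k+d-1) t))).                       *)
Fixpoint jconvergent (gamma beta : nat -> R) (d k : nat) : fps R :=
  if d is d'.+1 then
    fps_inv (jdenom (gamma k) (beta k.+1) (jconvergent gamma beta d' k.+1))
  else fun=> 0.

(* f is the value of the infinite J-fraction: the limit of the convergents    *)
(* for the t-adic topology, i.e., each coefficient is eventually constant.    *)
Definition eq_Jfraction (f : fps R) (gamma beta : nat -> R) : Prop :=
  forall n : nat, exists d0 : nat, forall d : nat,
    (d0 <= d)%N -> jconvergent gamma beta d 0%N n = f n.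

End JFraction.

(* Main.v *)
From HB Require Import structures.
Require Import Defs.
From mathcomp Require Import all_boot all_order all_fingroup all_algebra.
From mathcomp Require Import zify ring.

(* Fix the cycle type of every index; this is a Motzkin path, going up at     *)
(* cycle valleys and down at cycle peaks. Build sigma by choosing first the   *)
(* values sigma(k) < k, from left to right, and then the values sigma(k) > k, *)
(* from right to left. At each step the free targets on the correct side of k *)
(* number h (h + 1 at a valley), h being the height of the path before k, and *)
(* the rank of the chosen one among them is lnest(k) or unest(k), while its   *)
(* corank is lcross(k) or ucross(k); so the local weights sum to a factor     *)
(* depending only on the type and on h. A cycle is completed exactly at its   *)
(* minimum, a fixed point or a cycle valley, and at a valley exactly one of   *)
(* the h + 1 choices completes a cycle. Its rank is not controlled: this is   *)
(* why v_1 = y_1 and q_{+1} = p_{+1} are needed, and it gives the factor      *)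
(* lambda + h. Summing over Motzkin paths yields the J-fraction.              *)

Set Implicit Arguments.
Unset Strict Implicit.
Unset Printing Implicit Defensive.

Import GRing.Theory.
Local Open Scope ring_scope.

(** * Motzkin paths and J-fractions *)

(** Both sides enumerate weighted Motzkin paths. For the J-fraction this is [motzkin_jconvergent]:
    cutting a path at its first passage gives the recurrence solved by the inverse series, so a
    convergent of depth [d] counts paths correctly in all degrees below [d].

    For permutations it is [Qhat_motzkin]. Over a fixed word of cycle types, [sequential_sum] turns
    the sum into a product, provided that the sum of the local weights at each step does not depend
    on earlier choices. This is [sum_choice_weight], which rests on the number of free targets
    ([card_choices_low], [card_choices_drise], [card_choices_valley]) and on [valley_closing].

    The local weights multiply to the monomial of the permutation by [weight_prod]. Nestings and
    crossings are rank and corank among the free targets ([lnest_below], [lcross_above] and their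
    upper analogues); rank zero means antirecord or record ([low_antirecord], [up_record]);
    [psnest_at] at a fixed point is the height ([psnest_level]); the value at a valley closes a
    cycle exactly when the valley is the minimum of its cycle ([closes_cycle_min]). *)

Section Motzkin.

Variables (R : comNzRingType) (up level down : nat -> R).

(** Weighted paths of [n] steps from height [k + h] to height [k] that never go below [k]; a step is
    weighted by the absolute height at which it starts. *)
Fixpoint motzkin (k n h : nat) : R :=
  if n is m.+1 then
    level (k + h)%N * motzkin k m h + up (k + h)%N * motzkin k m h.+1
    + (if h is h'.+1 then down (k + h)%N * motzkin k m h' else 0)
  else (h == 0%N)%:R.

(** Cut the path around its first step from height [k + 1] to height [k]. The induction peels off
    the initial step of the path. *)
Lemma motzkin_first_passage k n h :
  motzkin k n h.+1 =
  down k.+1 * \sum_(i < n) motzkin k.+1 i h * motzkin k (n.-1 - i) 0.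
Proof.
elim: n h => [|n IHn] h; first by rewrite big_ord0 mulr0.
have IHn' h' : down k.+1 * \sum_(i < n) motzkin k.+1 i h' * motzkin k (n - i.+1) 0
    = motzkin k n h'.+1.
  by rewrite IHn; congr (_ * _); apply: eq_bigr => i _; congr (_ * motzkin k _ 0); lia.
rewrite [LHS]/= big_ord_recl /= subn0.
under eq_bigr => i _ do rewrite !mulrDl -!mulrA.
rewrite !big_split /= -!mulr_sumr addSnnS !mulrDr.
rewrite ![down _ * (level _ * _)]mulrCA ![down _ * (up _ * _)]mulrCA !IHn'.
case: h => [|h].
  rewrite mul1r addn1 [\sum_(i < n) _]big1 ?mulr0 => [|i _]; last by rewrite mul0r.
  by ring.
rewrite mul0r mulr0 add0r; congr (_ + _).
under eq_bigr => i _ do rewrite -!mulrA.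
by rewrite -mulr_sumr mulrCA IHn'.
Qed.

Lemma motzkin_rec k n :
  motzkin k n.+2 0 = level k * motzkin k n.+1 0
  + up k * down k.+1 * \sum_(i < n.+1) motzkin k.+1 i 0 * motzkin k (n - i) 0.
Proof.
rewrite -[LHS]/(level (k + 0)%N * motzkin k n.+1 0 + up (k + 0)%N * motzkin k n.+1 1 + 0).
by rewrite addr0 addn0 motzkin_first_passage mulrA.
Qed.

(** Only degrees up to [N] are tested, because a convergent is known to agree with the path counts
    in low degrees only. *)
Lemma fps_inv_uniq (f g : fps R) N : f 0%N = 1 ->
    (forall n, (n <= N)%N -> \sum_(i < n.+1) g i * f (n - i)%N = (n == 0%N)%:R) ->
  forall n, (n <= N)%N -> fps_inv f n = g n.
Proof.
move=> f0 gfE n; have [m] := ubnP n; elim: m n => // m IHm n; rewrite ltnS => nm nN.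
have := fps_invP n f0; rewrite -(gfE n nN) !big_ord_recr /= subnn f0 !mulr1.
rewrite (eq_bigr (fun i : 'I_n => g i * f (n - i)%N)); first exact: addrI.
by move=> i _; rewrite IHm //; have := ltn_ord i; lia.
Qed.

Lemma motzkin_jconvergent (gamma beta : nat -> R) d k n :
    gamma =1 level -> (forall h, beta h.+1 = up h * down h.+1) -> (n < d)%N ->
  jconvergent gamma beta d k n = motzkin k n 0.
Proof.
move=> gammaE betaE; elim: d k n => // d IHd k n; rewrite ltnS => nd.
rewrite /= gammaE betaE; apply: (fps_inv_uniq (g := fun n => motzkin k n 0) (N := d)) => // m md.
rewrite big_ord_recr /= subnn mulr1.
case: m md => [|[|m]] md; first by rewrite big_ord0 add0r.
  by rewrite big_ord1 /= addn0; ring.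
rewrite -/(motzkin k m.+2 0) motzkin_rec big_ord_recr /= subSn // subnn /=.
(* The reversal indexes the sum by the length of the inner path, as in [motzkin_rec]. *)
rewrite (reindex_inj rev_ord_inj) mulr_sumr.
rewrite (eq_bigr (fun i : 'I_m.+1 => - (up k * down k.+1 *
    (motzkin k.+1 i 0 * motzkin k (m - i) 0)))); last first.
  move=> i _; have im := ltn_ord i.
  rewrite /= (_ : (m.+2 - (m.+1 - i.+1) = i.+2)%N) /=; last by lia.
  rewrite IHd; last by lia.
  by rewrite subSS; ring.
by rewrite sumrN -/(motzkin k m.+1 0); ring.
Qed.

End Motzkin.

(** * Sums over values chosen one after the other *)

Section SequentialSum.

Variables (R : comNzRingType) (I : finType) (rk : I -> nat).
Variables (A : I -> {ffun I -> I} -> {set I}) (wt : I -> {ffun I -> I} -> I -> R).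
Variable fac : I -> R.
Hypothesis rk_inj : injective rk.
Hypothesis A_local : forall k (f g : {ffun I -> I}),
  (forall j, (rk j < rk k)%N -> f j = g j) -> A k f = A k g.
Hypothesis wt_local : forall k (f g : {ffun I -> I}),
  (forall j, (rk j < rk k)%N -> f j = g j) -> wt k f =1 wt k g.
Hypothesis sum_choices : forall k (f : {ffun I -> I}),
  (forall j, (rk j < rk k)%N -> f j \in A j f) -> \sum_(c in A k f) wt k f c = fac k.

(** The successive choices form a tree in which the weights of the children of a node add up to
    [fac k], whatever the node; summing from the leaves up factors these constants out. *)
Lemma sequential_sum :
  \sum_(f : {ffun I -> I} | [forall k, f k \in A k f]) \prod_k wt k f (f k)
  = \prod_k fac k.
Proof.
pose agree m (f0 f : {ffun I -> I}) := [forall j, (rk j < m)%N ==> (f j == f0 j)].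
have agreeP m (f0 f : {ffun I -> I}) :
    reflect (forall j, (rk j < m)%N -> f j = f0 j) (agree m f0 f).
  by apply: (iffP forallP) => + j => /(_ j); [move=> /implyP + jm => /(_ jm)/eqP|
    move=> fj; apply/implyP => /fj/eqP].
(* Only the values of [f0] at ranks below [m] matter: they are the choices already made. [N] bounds
   the ranks left; a rank carried by no index is skipped. *)
have main N m (f0 : {ffun I -> I}) : (forall k, (rk k < m + N)%N) ->
    (forall j, (rk j < m)%N -> f0 j \in A j f0) ->
    \sum_(f | agree m f0 f && [forall k, f k \in A k f])
       \prod_(k | (m <= rk k)%N) wt k f (f k) = \prod_(k | (m <= rk k)%N) fac k.
  elim: N m f0 => [|N IHN] m f0 rkN ok0.
    have nok k : (m <= rk k)%N = false by rewrite leqNgt -[m]addn0 rkN.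
    rewrite (big_pred1 f0) => [|f]; first by rewrite !big_pred0.
    apply/andP/eqP => [[/agreeP fE _]|->].
      by apply/ffunP => j; apply: fE; rewrite -[m]addn0.
    split; first exact/agreeP.
    by apply/forallP => k; apply: ok0; rewrite -[m]addn0.
  have [k rkk | nok] := pickP (fun k => rk k == m); last first.
    have rkS k : (m <= rk k)%N = (m < rk k)%N by rewrite leq_eqVlt eq_sym nok.
    have rkS' k : (rk k < m.+1)%N = (rk k < m)%N by rewrite ltnS leq_eqVlt nok.
    rewrite (eq_bigl _ _ rkS) -(IHN m.+1 f0).
    - apply: eq_big => [f|f _]; last exact: eq_bigl.
      by congr (_ && _); apply: eq_forallb => j; rewrite rkS'.
    - by move=> k; rewrite addSnnS.
    by move=> j; rewrite rkS'; apply: ok0.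
  have {}rkk := eqP rkk.
  have split_k (G : I -> R) :
      \prod_(j | (m <= rk j)%N) G j = G k * \prod_(j | (m < rk j)%N) G j.
    rewrite (bigD1 k) ?rkk //=; congr (_ * _); apply: eq_bigl => j.
    by rewrite ltn_neqAle -rkk (inj_eq rk_inj) eq_sym andbC.
  rewrite split_k (partition_big (fun f : {ffun I -> I} => f k) predT) //=.
  rewrite -(@sum_choices k f0) => [|j]; last by rewrite rkk; apply: ok0.
  rewrite mulr_suml [RHS]big_mkcond; apply: eq_bigr => c _.
  case: ifPn => cA; last first.
    rewrite big_pred0 // => f; apply/negP => /andP[/andP[/agreeP fE /forallP okf] /eqP fk].
    case/negP: cA; rewrite -fk -(@A_local k f) // => j; rewrite rkk; exact: fE.
  pose f1 := [ffun j => if j == k then c else f0 j].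
  have f1E j : (rk j < m)%N -> f1 j = f0 j.
    by rewrite ffunE; case: eqP => // ->; rewrite rkk ltnn.
  rewrite -(IHN m.+1 f1) => [|j|j].
  - rewrite mulr_sumr; apply: eq_big => [f|f].
      rewrite andbAC; congr (_ && _); apply/andP/agreeP => [[/agreeP fE /eqP fk] j|fE].
        rewrite ffunE; case: eqP => [-> // | /eqP jk]; rewrite ltnS leq_eqVlt.
        by rewrite -rkk (inj_eq rk_inj) (negPf jk) rkk; apply: fE.
      split; last by rewrite fE ?rkk // ffunE eqxx.
      by apply/agreeP => j jm; rewrite fE ?f1E // ltnS ltnW.
    move=> /andP[/andP[/agreeP fE _] /eqP fk]; rewrite split_k fk.
    by rewrite (@wt_local k f f0) // => j; rewrite rkk; apply: fE.
  - by rewrite addSnnS.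
  rewrite ltnS leq_eqVlt => /orP[/eqP|] jm.
    have -> : j = k by apply: rk_inj; rewrite rkk.
    by rewrite ffunE eqxx (@A_local k f1 f0) // => i; rewrite rkk; apply: f1E.
  by rewrite f1E // (@A_local j f1 f0) ?ok0 // => i ij; apply: f1E; apply: ltn_trans jm.
pose f0 : {ffun I -> I} := [ffun k => k].
rewrite -(main (\max_k rk k).+1 0%N f0) => // [|k]; last first.
  by rewrite add0n ltnS leq_bigmax.
by apply: eq_bigl => f; rewrite (_ : agree _ _ _) //; apply/agreeP.
Qed.

End SequentialSum.

(** * Generating function of the rank in a finite ordered set *)

Section RankSum.

Variables (R : comNzRingType).

(* Vanishes at h = 0, so that paths going below level 0 do not contribute.    *)
Definition arc_sum (p q x u : R) (h : nat) : R :=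
  \sum_(r < h) (if (r == 0 :> nat)%N then x else u) * p ^+ (h.-1 - r) * q ^+ r.

Lemma arc_sumS p q x u h :
  arc_sum p q x u h.+1 = p ^+ h * x + q * pqint p q h * u.
Proof.
rewrite /arc_sum big_ord_recl /= subn0 mulr1 mulrC; congr (_ + _).
rewrite /pqint mulr_sumr mulr_suml; apply: eq_bigr => i _; rewrite /bump /= exprS.
rewrite (_ : (h - (1 + i) = h.-1 - i)%N); last by lia.
by ring.
Qed.

Variables (T : finType) (key : T -> nat).
Hypothesis key_inj : injective key.

Implicit Type A : {set T}.

Definition below A c := #|[set d in A | key d < key c]%N|.
Definition above A c := #|[set d in A | key c < key d]%N|.

Lemma below_above A c : c \in A -> (below A c + above A c).+1 = #|A|.
Proof.
move=> cA; rewrite (cardsD1 c) cA add1n; congr _.+1.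
rewrite -(cardsID [set d | key d < key c]%N (A :\ c)); congr (_ + _)%N; apply: eq_card => d.
  by rewrite !inE; case: eqP => [->|_]; rewrite ?ltnn ?andbF.
rewrite !inE -leqNgt ltn_neqAle (inj_eq key_inj) (eq_sym c).
by case: (d == c); case: (d \in A); case: (_ <= _)%N.
Qed.

(** The element of largest key has rank [#|A| - 1], and removing it changes no other rank. *)
Lemma rank_sum A (g : nat -> R) : \sum_(c in A) g (below A c) = \sum_(r < #|A|) g r.
Proof.
move eqN: #|A| => N; elim: N A eqN => [|N IHN] A AN.
  by move/eqP: AN; rewrite cards_eq0 => /eqP->; rewrite big_set0 big_ord0.
have [c0 c0A] : exists c, c \in A by apply/card_gt0P; rewrite AN.
have [c cA cmax] : exists2 c, c \in A & forall d, d \in A -> (key d <= key c)%N.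
  by case: (arg_maxnP key c0A) => c; exists c.
have belowc d : d \in A -> (key d < key c)%N = (d != c).
  by move=> dA; rewrite ltn_neqAle (inj_eq key_inj) cmax ?andbT.
rewrite (big_setD1 c) //= big_ord_recr /= addrC -(IHN (A :\ c)); last first.
  by move: AN; rewrite (cardsD1 c) cA => -[].
congr (_ + _); last first.
  congr g; apply/eqP; rewrite -eqSS -AN (cardsD1 c) cA add1n eqSS; apply/eqP/eq_card => d.
  by rewrite !inE andbC; case: (boolP (d \in A)) => [/belowc->|]; rewrite ?andbF ?andbT.
apply: eq_bigr => d /setD1P[dc dA]; congr g; apply: eq_card => e; rewrite !inE.
case: (altP (e =P c)) => [->|//]; rewrite cA /=.
by apply/negbTE; rewrite -leqNgt; apply: cmax.
Qed.

(** The rank will be a nesting number and the corank a crossing number; rank zero is the record or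
    antirecord case, marked by [x] instead of [u]. *)
Definition arc_weight (p q x u : R) A c :=
  (if below A c == 0%N then x else u) * p ^+ above A c * q ^+ below A c.

Lemma sum_arc_weight A (p q x u : R) :
  \sum_(c in A) arc_weight p q x u A c = arc_sum p q x u #|A|.
Proof.
pose g r := (if (r == 0)%N then x else u) * p ^+ (#|A|.-1 - r) * q ^+ r.
rewrite /arc_sum -(rank_sum A g) /g.
by apply: eq_bigr => c cA; rewrite /arc_weight -(below_above cA) /= addKn.
Qed.

End RankSum.

(** * Words of cycle types *)

(* [None] stands for a fixed point and [Some (a, b)] for an index i where [a] *)
(* tells whether sigma(i) > i and [b] whether sigma^-1(i) < i.                *)
Definition cycle_type : Type := option (bool * bool).
HB.instance Definition _ := Finite.on cycle_type.

Definition valley : cycle_type := Some (true, false).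
Definition peak : cycle_type := Some (false, true).
Definition drise : cycle_type := Some (true, true).
Definition dfall : cycle_type := Some (false, false).

Lemma sum_cycle_type (R : nmodType) (F : cycle_type -> R) :
  \sum_t F t = F dfall + F drise + F None + F valley + F peak.
Proof.
rewrite (bigD1 None) // (bigD1 valley) // (bigD1 peak) // (bigD1 drise) // (bigD1 dfall) //=.
by rewrite big_pred0 => [|[[[] []]|] //]; rewrite addr0 !addrA [LHS](ACl (5*4*1*2*3)).
Qed.

Lemma sum_tuple_cons (R : nmodType) (T : finType) n (P : pred (n.+1.-tuple T))
    (F : n.+1.-tuple T -> R) :
  \sum_(t : n.+1.-tuple T | P t) F t
  = \sum_(a : T) \sum_(t : n.-tuple T | P [tuple of a :: t]) F [tuple of a :: t].
Proof.
rewrite (reindex (fun p : T * n.-tuple T => [tuple of p.1 :: p.2])) /=; last first.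
  exists (fun t => (thead t, [tuple of behead t])) => [[a t] _ | t _].
    by congr pair; apply: val_inj.
  by rewrite /= -tuple_eta.
by rewrite pair_big_dep.
Qed.

Definition height (h : nat) (ts : seq cycle_type) : nat :=
  h + count_mem valley ts - count_mem peak ts.

Section MotzkinWords.

Variables (R : comNzRingType) (fac : cycle_type -> nat -> R).
Hypothesis fac_peak0 : fac peak 0 = 0.

(** The sum also runs over words whose path would go below 0. Such a word has a peak at height 0,
    where [fac] vanishes, so the truncated subtraction in [height] does no harm. *)
Lemma motzkin_words n h :
  \sum_(ts : n.-tuple cycle_type | (h + count_mem valley ts == count_mem peak ts)%N)
     \prod_(k < n) fac (nth None ts k) (height h (take k ts))
  = motzkin (fac valley) (fun h => fac dfall h + fac drise h + fac None h) (fac peak) 0 n h.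
Proof.
elim: n h => [|n IHn] h.
  rewrite (eq_bigr (fun=> 1)) => [|ts _]; last by rewrite big_ord0.
  case: h => [|h]; last by rewrite big_pred0 // => ts; rewrite tuple0.
  by rewrite (big_pred1 [tuple]) // => ts /=; rewrite (tuple0 ts); apply/esym/eqP.
rewrite sum_tuple_cons sum_cycle_type [RHS]/= !mulrDl -!IHn add0n.
have step (a : cycle_type) (h' : nat) :
    (forall ts : seq cycle_type, height h (a :: ts) = height h' ts) ->
    (forall ts : n.-tuple cycle_type,
       (h + count_mem valley (a :: ts) == count_mem peak (a :: ts))%N
       = (h' + count_mem valley ts == count_mem peak ts)%N) ->
    \sum_(ts : n.-tuple cycle_type
           | (h + count_mem valley (a :: ts) == count_mem peak (a :: ts))%N)
      \prod_(k < n.+1) fac (nth None (a :: ts) k) (height h (take k (a :: ts)))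
    = fac a h * \sum_(ts : n.-tuple cycle_type | (h' + count_mem valley ts == count_mem peak ts)%N)
     \prod_(k < n) fac (nth None ts k) (height h' (take k ts)).
  move=> hE cE; rewrite mulr_sumr; apply: eq_big => [// | ts _].
  rewrite big_ord_recl /=; congr (_ * _); first by rewrite /height /= addn0 subn0.
  by apply: eq_bigr => i _; rewrite hE.
congr (_ + _ + _ + _ + _).
- exact: step.
- exact: step.
- exact: step.
- by apply: step => ts; rewrite /height /= addnA addn1.
case: h step => [|h] step; last by rewrite -IHn; apply: step.
by apply: big1 => ts _; rewrite big_ord_recl /= /height /= subnn fac_peak0 mul0r.
Qed.

End MotzkinWords.

(** * Permutations with a given word *)

Definition up_source (t : cycle_type) := if t is Some (a, _) then a else false.
Definition low_source (t : cycle_type) := if t is Some (a, _) then ~~ a else false.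
Definition up_target (t : cycle_type) := if t is Some (_, b) then b else false.
Definition low_target (t : cycle_type) := if t is Some (_, b) then ~~ b else false.

(** Extend [f] from [B] minus a point [a], then correct the value at [a] by a transposition;
    injectivity on [B] keeps the other values in place. *)
Lemma perm_extension (T : finType) (B : {set T}) (f : T -> T) :
  {in B &, injective f} -> exists pi : {perm T}, {in B, pi =1 f}.
Proof.
have [m] := ubnP #|B|; elim: m B => // m IHm B; rewrite ltnS => Bm f_inj.
have [->|[a aB]] := set_0Vmem B; first by exists 1%g => x; rewrite inE.
have [||pi piE] := IHm (B :\ a).
- by move: Bm; rewrite (cardsD1 a) aB.
- by move=> x y /setD1P[_ xB] /setD1P[_ yB]; apply: f_inj.
exists (pi * tperm (pi a) (f a))%g => b bB; rewrite permM.
have [->|ba] := eqVneq b a; first by rewrite tpermL.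
have pib : pi b = f b by apply: piE; rewrite !inE ba.
rewrite tpermD //; first by rewrite (inj_eq perm_inj) eq_sym.
rewrite pib.
by apply: contra ba => /eqP/f_inj->.
Qed.

Lemma connect_iterP (T : finType) (B : pred T) (f : T -> T) c k :
  reflect (exists2 m, iter m f c = k & forall i, (i < m)%N -> B (iter i f c))
          (connect [rel a b | B a && (f a == b)] c k).
Proof.
apply: (iffP connectP) => [[p]|[m <-{k}]].
  elim: p c => [|b p IHp] c /= => [_ ->|/andP[/andP[Bc /eqP <-]] pp kE].
    by exists 0%N.
  have [m mE mB] := IHp _ pp kE; exists m.+1; rewrite ?iterSr // => -[//|i].
  by rewrite ltnS iterSr; apply: mB.
elim: m => [|m IHm] Bi; first by exists [::].
have [i im|p pp pE] := IHm; first by apply: Bi; apply: ltnW.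
exists (rcons p (iter m.+1 f c)); last by rewrite last_rcons.
by rewrite rcons_path pp -pE /= Bi ?eqxx.
Qed.

(* Extend f to a permutation pi and follow pi backwards from k until the      *)
(* first point outside B: the point reached just before is the source.        *)
Lemma unique_path_source (T : finType) (B : pred T) (f : T -> T) (k : T) :
    {in B &, injective f} -> ~~ B k ->
  exists2 t, connect [rel a b | B a && (f a == b)] t k
             /\ (forall b, B b -> f b != t)
    & forall c, connect [rel a b | B a && (f a == b)] c k ->
                (forall b, B b -> f b != c) -> c = t.
Proof.
move=> f_inj Bk.
have [pi piE] : exists pi : {perm T}, {in [set x | B x], pi =1 f}.
  by apply: perm_extension => x y; rewrite !inE; apply: f_inj.
have {}piE x : B x -> pi x = f x by move=> Bx; apply: piE; rewrite inE.
pose back i := (pi^-1 ^+ i)%g k.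
have backS i : pi (back i.+1) = back i by rewrite /back expgSr permM permKV.
have [N NB Nmin] : exists2 N, ~~ B (back N.+1) & forall i, (i < N)%N -> B (back i.+1).
  (* After as many steps as the order of the inverse permutation, the backward walk is at [k] again,
     which lies outside [B]. *)
  have exN : exists N, ~~ B (back N.+1).
    exists #[pi^-1%g]%g.-1; rewrite prednK ?order_gt0 // /back expg_order perm1.
    exact: Bk.
  case: (ex_minnP exN) => N NB Nmin; exists N => // i iN.
  by apply: contraLR iN => /Nmin; rewrite -leqNgt.
have iter_back m : (forall i, (i < m)%N -> B (back i.+1)) ->
    forall i, (i <= m)%N -> iter i f (back m) = back (m - i)%N.
  move=> mB; elim=> [|i IHi] im; first by rewrite subn0.
  rewrite iterS IHi 1?ltnW // (_ : (m - i = (m - i.+1).+1)%N); last by lia.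
  by rewrite -piE ?backS // mB //; lia.
have back_connect m c : iter m f c = k -> (forall i, (i < m)%N -> B (iter i f c)) ->
    forall i, (i <= m)%N -> back i = iter (m - i)%N f c.
  move=> mk mB; elim=> [|i IHi] im; first by rewrite subn0 mk /back expg0 perm1.
  apply: (@perm_inj _ pi); rewrite backS IHi 1?ltnW // piE; last by apply: mB; lia.
  by rewrite -iterS (_ : ((m - i.+1).+1 = m - i)%N) //; lia.
exists (back N); first split.
- apply/connect_iterP; exists N; first by rewrite iter_back // subnn /back expg0 perm1.
  move=> i iN; rewrite iter_back 1?ltnW // (_ : (N - i = (N - i.+1).+1)%N); last by lia.
  by apply: Nmin; lia.
- move=> b Bb; apply: contraNneq NB => fb.
  by rewrite -(_ : b = back N.+1) //; apply: (@perm_inj _ pi); rewrite backS piE.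
move=> c /connect_iterP[m mk mB] cB.
have cE : back m = c by rewrite (back_connect m c) // subnn.
have bB i : (i < m)%N -> B (back i.+1).
  by move=> im; rewrite (back_connect m c) //; apply: mB; lia.
have [mN|Nm|mN] := ltngtP m N; last 2 first.
- by case/negP: NB; apply: bB.
- by rewrite -cE mN.
by have := cB _ (Nmin _ mN); rewrite -piE ?Nmin // backS cE eqxx.
Qed.

Section FixedWord.

Variables (n : nat) (tau : 'I_n -> cycle_type).
Implicit Types (f g : {ffun 'I_n -> 'I_n}) (i j k c : 'I_n).

(* The values are chosen in the order of increasing [rank]: first those below *)
(* the diagonal, from left to right, then all others, from right to left.     *)
Definition rank k : nat := (if low_source (tau k) then k : nat else n + n - k)%N.

Definition before j k := (rank j < rank k)%N.

Definition allowed k c :=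
  match tau k with
  | Some (true, _) => (k < c)%N && up_target (tau c)
  | Some (false, _) => (c < k)%N && low_target (tau c)
  | None => c == k
  end.

Definition choices k f : {set 'I_n} :=
  [set c | allowed k c & [forall j, before j k ==> (f j != c)]].

(** The arcs chosen before [k] lead from [c] to [k], so that sending [k] to [c] completes a
    cycle. *)
Definition closes k f c := connect [rel a b | before a k && (f a == b)] c k.

Definition count_type (P : pred cycle_type) (Q : pred 'I_n) : nat :=
  #|[set j | Q j & P (tau j)]|.

Definition level k : nat :=
  (count_type (pred1 valley) (fun j => j < k) - count_type (pred1 peak) (fun j => j < k))%N.

Lemma rank_inj : injective rank.
Proof.
move=> i j; rewrite /rank; have := (ltn_ord i, ltn_ord j) => -[ilt jlt].
by case: ifP => _; case: ifP => _ ij; apply: val_inj => /=; lia.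
Qed.

Lemma beforeE j k : before j k =
  if low_source (tau k) then low_source (tau j) && (j < k)%N
  else low_source (tau j) || (k < j)%N.
Proof.
rewrite /before /rank; have := (ltn_ord j, ltn_ord k) => -[jlt klt].
by case: ifP => _; case: ifP => _ /=; lia.
Qed.

Lemma choices_local k f g :
  (forall j, before j k -> f j = g j) -> choices k f = choices k g.
Proof.
move=> fg; apply/setP => c; rewrite !inE; congr (_ && _).
apply: eq_forallb => j; case: (boolP (before j k)) => //= jk.
by rewrite fg.
Qed.

Lemma closes_local k f g :
  (forall j, before j k -> f j = g j) -> closes k f =1 closes k g.
Proof.
move=> fg c; apply: eq_connect => a b /=.
by case: (boolP (before a k)) => //= /fg->.
Qed.

Lemma choicesP k f c :
  reflect (allowed k c /\ forall j, before j k -> f j != c) (c \in choices k f).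
Proof.
rewrite inE; apply: (iffP andP) => -[kc fc]; split=> //.
  by move=> j jk; move/forallP/(_ j): fc; rewrite jk.
by apply/forallP => j; apply/implyP => /fc.
Qed.

Lemma count_typeU (P P' : pred cycle_type) Q :
  (forall t, ~~ (P t && P' t)) ->
  count_type [predU P & P'] Q = (count_type P Q + count_type P' Q)%N.
Proof.
move=> PP'; rewrite /count_type -cardsUI (_ : _ :&: _ = set0) ?cards0 ?addn0; last first.
  by apply/setP => j; rewrite !inE andbACA (negPf (PP' _)) andbF.
by apply: eq_card => j; rewrite !inE /= andb_orr.
Qed.

Lemma count_low_source Q :
  count_type low_source Q = (count_type (pred1 peak) Q + count_type (pred1 dfall) Q)%N.
Proof.
rewrite -count_typeU => [|[[[] []]|]//]; apply: eq_card => j; rewrite !inE.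
by case: (tau j) => [[[] []]|].
Qed.

Lemma count_up_source Q :
  count_type up_source Q = (count_type (pred1 valley) Q + count_type (pred1 drise) Q)%N.
Proof.
rewrite -count_typeU => [|[[[] []]|]//]; apply: eq_card => j; rewrite !inE.
by case: (tau j) => [[[] []]|].
Qed.

Lemma count_low_target Q :
  count_type low_target Q = (count_type (pred1 valley) Q + count_type (pred1 dfall) Q)%N.
Proof.
rewrite -count_typeU => [|[[[] []]|]//]; apply: eq_card => j; rewrite !inE.
by case: (tau j) => [[[] []]|].
Qed.

Lemma count_up_target Q :
  count_type up_target Q = (count_type (pred1 peak) Q + count_type (pred1 drise) Q)%N.
Proof.
rewrite -count_typeU => [|[[[] []]|]//]; apply: eq_card => j; rewrite !inE.
by case: (tau j) => [[[] []]|].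
Qed.

(** * Counting the free targets at one step *)

Section Prior.

Variables (k : 'I_n) (f : {ffun 'I_n -> 'I_n}).
Hypothesis prior : forall j, before j k -> f j \in choices j f.

Lemma prior_allowed j : before j k -> allowed j (f j).
Proof. by move=> /prior/choicesP[]. Qed.

Lemma prior_inj : {in [pred j | before j k] &, injective f}.
Proof.
move=> i j; rewrite !inE.
wlog ij : i j / (rank i <= rank j)%N => [Wij|] ik jk fij.
  by case/orP: (leq_total (rank i) (rank j)) => [ij|ji]; [|apply/esym]; apply: Wij.
move: ij; rewrite leq_eqVlt => /orP[/eqP/rank_inj // | ij].
by have /choicesP[_ /(_ _ ij)] := prior jk; rewrite fij eqxx.
Qed.

Lemma choices_fixed : tau k = None -> choices k f = [set k].
Proof.
move=> tk; apply/setP => c; rewrite in_set1.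
apply/choicesP/eqP => [[] | ->]; first by rewrite /allowed tk => /eqP.
split=> [|j jk]; first by rewrite /allowed tk.
have := prior_allowed jk; rewrite /allowed.
case tj: (tau j) => [[[] b]|].
- by move=> /andP[_]; apply: contraTneq => ->; rewrite tk.
- by move=> /andP[_]; apply: contraTneq => ->; rewrite tk.
by move=> /eqP->; apply: contraTneq jk => ->; rewrite /before ltnn.
Qed.

(** The free targets are the low targets left of [k] minus the images of the low sources left of
    [k]. Double falls occur in both sets, valleys only as targets, peaks only as sources. *)
Lemma card_choices_low : low_source (tau k) -> #|choices k f| = level k.
Proof.
move=> lk; pose B := [set j : 'I_n | (j < k)%N & low_source (tau j)].
have Bk j : j \in B -> before j k by rewrite inE beforeE lk andbC.
have -> : choices k f = [set c : 'I_n | (c < k)%N & low_target (tau c)] :\: f @: B.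
  apply/setP => c; rewrite !inE andbC; congr (_ && _); last first.
    by move: lk; rewrite /allowed; case: (tau k) => [[[]]|].
  apply/forallP/idP => [fc|fc j].
    by apply/imsetP => -[j /Bk jk cE]; have := fc j; rewrite jk cE eqxx.
  apply/implyP => jk; apply: contra fc => /eqP<-; apply: imset_f.
  by move: jk; rewrite inE beforeE lk andbC.
rewrite cardsDS; last first.
  apply/subsetP => _ /imsetP[j jB ->]; have := prior_allowed (Bk _ jB).
  move: jB; rewrite !inE /allowed; case: (tau j) => [[[] b]|] /andP[jk] // _.
  by move=> /andP[fj ->]; rewrite (ltn_trans fj).
rewrite card_in_imset => [|i j /Bk ik /Bk jk]; last exact: prior_inj.
rewrite -/(count_type low_target _) -/(count_type low_source _).
by rewrite count_low_source count_low_target subnDr.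
Qed.

(** Mirror image of the low case: low sources are sent to low targets and fixed points to
    themselves, so only up sources right of [k] have used up targets. *)
Lemma card_choices_up :
    up_source (tau k) ->
  #|choices k f| = (count_type (pred1 peak) (fun j => k < j)%N
                    - count_type (pred1 valley) (fun j => k < j)%N)%N.
Proof.
move=> uk; pose B := [set j : 'I_n | (k < j)%N & up_source (tau j)].
have lk : low_source (tau k) = false by move: uk; case: (tau k) => [[[]]|].
have Bk j : j \in B -> before j k by rewrite inE beforeE lk => /andP[-> _]; rewrite orbT.
have -> : choices k f = [set c : 'I_n | (k < c)%N & up_target (tau c)] :\: f @: B.
  apply/setP => c; rewrite in_setD andbC; apply/choicesP/andP => -[].
    move=> kc fc; split; first by move: kc uk; rewrite inE /allowed; case: (tau k) => [[[]]|].
    by apply/imsetP => -[j /Bk jk cE]; have := fc j jk; rewrite cE eqxx.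
  rewrite inE => /andP[kc uc] cB; split.
    by move: uk; rewrite /allowed kc uc; case: (tau k) => [[[]]|].
  move=> j jk; apply: contra cB => /eqP fj; rewrite -fj; apply: imset_f.
  have := prior_allowed jk; move: jk; rewrite inE beforeE lk /allowed fj.
  case tj: (tau j) => [[[] b]|] /=; first by move=> ->.
    by move=> _ /andP[_]; move: uc; case: (tau c) => [[? []]|].
  by move=> _ /eqP cj; move: uc; rewrite cj tj.
rewrite cardsDS; last first.
  apply/subsetP => _ /imsetP[j jB ->]; have := prior_allowed (Bk _ jB).
  move: jB; rewrite !inE /allowed; case: (tau j) => [[[] b]|] /andP[jk] // _.
  by move=> /andP[fj ->]; rewrite (ltn_trans jk).
rewrite card_in_imset => [|i j /Bk ik /Bk jk]; last exact: prior_inj.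
rewrite -/(count_type up_target _) -/(count_type up_source _).
by rewrite count_up_source count_up_target subnDr.
Qed.

Hypothesis k_not_low : ~~ low_source (tau k).

Lemma before_low j : low_source (tau j) -> before j k.
Proof. by move=> lj; rewrite beforeE (negPf k_not_low) lj. Qed.

Lemma low_allowed j : low_source (tau j) -> (f j < j)%N && low_target (tau (f j)).
Proof.
move=> lj; have := prior_allowed (before_low lj); move: lj.
by rewrite /allowed; case: (tau j) => [[[]]|].
Qed.

(** All low values are known by now, and they map the low sources left of [k] injectively to low
    targets left of [k]. Hence the subtraction in [level] is not truncated. *)
Lemma peaks_le_valleys :
  (count_type (pred1 peak) (fun j => j < k) <= count_type (pred1 valley) (fun j => j < k))%N.
Proof.
rewrite -(leq_add2r (count_type (pred1 dfall) (fun j => j < k)%N)).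
rewrite -count_low_source -count_low_target.
rewrite /count_type -(card_in_imset (f := f)) => [|i j]; last first.
  rewrite !inE => /andP[_ /before_low ik] /andP[_ /before_low jk]; exact: prior_inj.
apply/subset_leq_card/subsetP => _ /imsetP[j + ->]; rewrite !inE => /andP[jk].
by move=> /low_allowed/andP[fj ->]; rewrite (ltn_trans fj).
Qed.

Hypothesis balanced :
  count_type (pred1 valley) predT = count_type (pred1 peak) predT.

Lemma count_type_split P :
  count_type P predT
  = (count_type P (fun j => j < k) + P (tau k) + count_type P (fun j => k < j))%N.
Proof.
rewrite /count_type (cardsD1 k) inE /= addnAC addnC; congr (_ + _)%N.
rewrite -(cardsID [set j : 'I_n | (j < k)%N]); congr (_ + _)%N; apply: eq_card => j.
  rewrite !inE /= -val_eqE /=; case: ltngtP => //=; rewrite ?andbF ?andbT //.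
rewrite !inE /= -val_eqE /=; case: ltngtP => //=; rewrite ?andbF ?andbT //.
Qed.

Lemma card_choices_drise : tau k = drise -> #|choices k f| = level k.
Proof.
move=> tk; rewrite card_choices_up ?tk // /level.
by have := balanced; rewrite !count_type_split /= tk /=; lia.
Qed.

(** By balance, peaks minus valleys to the right of [k] equals valleys minus peaks to its left, plus
    one for the valley [k] itself. *)
Lemma card_choices_valley : tau k = valley -> #|choices k f| = (level k).+1.
Proof.
move=> tk; rewrite card_choices_up ?tk // /level; have := peaks_le_valleys.
by have := balanced; rewrite !count_type_split /= tk /=; lia.
Qed.

(* The backward path from the valley k ends above k: it cannot come from      *)
(* below, since a processed index below k is sent further down.               *)
Lemma valley_closing : tau k = valley ->
  exists2 t, t \in choices k f /\ closes k f t
    & forall c, c \in choices k f -> closes k f c -> c = t.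
Proof.
move=> tk.
have [||t [tk_path t_free] t_uniq] := @unique_path_source _ (before^~ k) f k.
- exact: prior_inj.
- by rewrite /before ltnn.
exists t; last by move=> c /choicesP[_ c_free] ck; apply: t_uniq.
split=> //; apply/choicesP; split=> //.
(* By balance there are as many low sources as low targets, so the first phase has used up all low
   targets and the free point [t] is not one of them. *)
have lt_hit : f @: [set j | low_source (tau j)] = [set c | low_target (tau c)].
  apply/eqP; rewrite eqEcard; apply/andP; split.
    by apply/subsetP => _ /imsetP[j + ->]; rewrite !inE => /low_allowed/andP[].
  rewrite card_in_imset => [|i j]; last first.
    by rewrite !inE => /before_low ik /before_low jk; apply: prior_inj.
  rewrite -/(count_type low_target predT) -/(count_type low_source predT).
  by rewrite count_low_source count_low_target balanced.
have t_nlow : ~~ low_target (tau t).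
  apply/negP => lt; have /imsetP[j] : t \in f @: [set j | low_source (tau j)].
    by rewrite lt_hit inE.
  by rewrite inE => /before_low/t_free + tE; rewrite -tE eqxx.
have t_neq_k : t != k by apply: contraNneq t_nlow => ->; rewrite tk.
have [m mk mB] := connect_iterP _ _ _ _ tk_path.
have tB : before t k.
  by case: m mk mB => [/= tE|m _ /(_ 0%N)->] //; rewrite tE eqxx in t_neq_k.
(* A processed fixed point is its own image, hence not free. *)
have t_up : up_target (tau t).
  move: t_nlow; case tt: (tau t) => [[a []]|] //= _.
  by have := t_free _ tB; have := prior_allowed tB; rewrite /allowed tt => ->.
rewrite /allowed tk t_up andbT ltnNge; apply/negP => t_le_k.
have {t_le_k} t_lt_k : (t < k)%N by rewrite ltn_neqAle t_neq_k.
have : (iter m f t < k)%N; last by rewrite mk ltnn.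
elim: {mk} m mB => // m IHm mB; have xk : (iter m f t < k)%N.
  by apply: IHm => i im; apply: mB; apply: ltnW.
have := mB m (ltnSn m); rewrite beforeE (negPf k_not_low) [(k < _)%N]ltnNge (ltnW xk) orbF.
by move=> /low_allowed/andP[fx _]; apply: ltn_trans xk.
Qed.

End Prior.

End FixedWord.

(** * Local weights and their sum over the choices *)

Section Weights.

Variables (R : comNzRingType) (x1 x2 y1 y2 u1 u2 v2 : R).
Variables (pp1 pp2 pm1 pm2 qp2 qm1 qm2 : R) (s lambda : R) (w : nat -> R).

Definition step_sum (t : cycle_type) (h : nat) : R :=
  match t with
  | Some (false, false) => arc_sum pm2 qm2 x2 u2 h
  | Some (false, true) => arc_sum pm1 qm1 x1 u1 h
  | Some (true, true) => arc_sum pp2 qp2 y2 v2 h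
  | Some (true, false) => (lambda + h%:R) * pp1 ^+ h * y1
  | None => lambda * s ^+ h * w h
  end.

Definition rightward n (c : 'I_n) : nat := c.
(** Upper nestings come from free targets to the right of the chosen one, so up targets are ranked
    from the right. *)
Definition leftward n (c : 'I_n) : nat := (n - c)%N.

Lemma rightward_inj n : injective (@rightward n).
Proof. exact: val_inj. Qed.

Lemma leftward_inj n : injective (@leftward n).
Proof.
move=> c d; rewrite /leftward => cd; apply: val_inj => /=.
by have := ltn_ord c; have := ltn_ord d; lia.
Qed.

Section FixedWord.

Variables (n : nat) (tau : 'I_n -> cycle_type).

(** At a valley only rank plus corank enters, which is the same for every choice; the factor
    [lambda] may then sit on a target of unknown rank. *)
Definition choice_weight (k : 'I_n) (f : {ffun 'I_n -> 'I_n}) (c : 'I_n) : R :=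
  let A := choices tau k f in
  match tau k with
  | Some (false, false) => arc_weight (@rightward n) pm2 qm2 x2 u2 A c
  | Some (false, true) => arc_weight (@rightward n) pm1 qm1 x1 u1 A c
  | Some (true, true) => arc_weight (@leftward n) pp2 qp2 y2 v2 A c
  | Some (true, false) =>
      y1 * pp1 ^+ (below (@leftward n) A c + above (@leftward n) A c)
      * (if closes tau k f c then lambda else 1)
  | None => lambda * s ^+ level tau k * w (level tau k)
  end.

Hypothesis balanced :
  count_type tau (pred1 valley) predT = count_type tau (pred1 peak) predT.

Lemma sum_choice_weight (k : 'I_n) (f : {ffun 'I_n -> 'I_n}) :
    (forall j, before tau j k -> f j \in choices tau j f) ->
  \sum_(c in choices tau k f) choice_weight k f c = step_sum (tau k) (level tau k).
Proof.
move=> prior; rewrite /choice_weight /step_sum; case tk: (tau k) => [[[] []]|].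
- rewrite sum_arc_weight; last exact: leftward_inj.
  by rewrite (card_choices_drise prior) ?tk.
- have nlow : ~~ low_source (tau k) by rewrite tk.
  have [t [tA tc] t_uniq] := valley_closing prior nlow balanced tk.
  have cA := card_choices_valley prior nlow balanced tk.
  rewrite (eq_bigr (fun c => y1 * pp1 ^+ level tau k
             * (if c == t then lambda else 1))) => [|c cin]; last first.
    rewrite -[level _ _]/(_.+1.-1) -cA -(below_above (@leftward_inj n) cin).
    congr (_ * _); case: eqP => [->|ct]; first by rewrite tc.
    by case: ifP => // /(t_uniq _ cin).
  rewrite -mulr_sumr (big_setD1 t) //= eqxx.
  rewrite (eq_bigr (fun=> 1)) => [|c /setD1P[/negPf->]] //.
  rewrite sumr_const.
  have -> : #|choices tau k f :\ t| = level tau k.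
    by move: cA; rewrite (cardsD1 t) tA => -[].
  by ring.
- rewrite sum_arc_weight; last exact: rightward_inj.
  by rewrite (card_choices_low prior) ?tk.
- rewrite sum_arc_weight; last exact: rightward_inj.
  by rewrite (card_choices_low prior) ?tk.
by rewrite (choices_fixed prior tk) big_set1.
Qed.

Lemma sum_fixed_word :
  \sum_(f : {ffun 'I_n -> 'I_n} | [forall k, f k \in choices tau k f])
     \prod_k choice_weight k f (f k)
  = \prod_k step_sum (tau k) (level tau k).
Proof.
apply: (sequential_sum (rk := rank tau)).
- exact: rank_inj.
- by move=> k f g fg; apply: choices_local.
- move=> k f g fg c; rewrite /choice_weight.
  by rewrite (choices_local fg) (closes_local fg).
exact: sum_choice_weight.
Qed.

End FixedWord.

End Weights.

(** * The statistics of a permutation *)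

Lemma cycle_type_inj t t' : up_source t = up_source t' -> low_source t = low_source t' ->
  up_target t = up_target t' -> t = t'.
Proof. by case: t t' => [[[] []]|] [[[] []]|]. Qed.

Section PermutationWord.

Variable n : nat.
Implicit Types (sigma : 'S_n) (i j k c : 'I_n).

Definition type_of sigma i : cycle_type :=
  if sigma i == i then None else Some ((i < sigma i)%N, (sigma^-1%g i < i)%N).

Lemma perm_inv_fix sigma i : (sigma^-1%g i == i) = (sigma i == i).
Proof. by rewrite -(inj_eq (@perm_inj _ sigma)) permKV eq_sym. Qed.

Lemma up_source_type_of sigma i : up_source (type_of sigma i) = (i < sigma i)%N.
Proof. by rewrite /type_of; case: eqP => [->|]; rewrite ?ltnn. Qed.

Lemma low_source_type_of sigma i : low_source (type_of sigma i) = (sigma i < i)%N.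
Proof.
by rewrite /type_of -val_eqE /=; case: ltngtP => //=.
Qed.

Lemma up_target_type_of sigma i : up_target (type_of sigma i) = (sigma^-1%g i < i)%N.
Proof.
by rewrite /type_of -perm_inv_fix; case: eqP => [->|]; rewrite ?ltnn.
Qed.

Lemma low_target_type_of sigma i : low_target (type_of sigma i) = (i < sigma^-1%g i)%N.
Proof.
by rewrite /type_of -perm_inv_fix -val_eqE /=; case: (ltngtP (val (sigma^-1%g i))) => //=.
Qed.

Lemma cpeak_type_of sigma i : cpeak sigma i = (type_of sigma i == peak).
Proof.
rewrite /cpeak -up_target_type_of -low_source_type_of.
by case: (type_of sigma i) => [[[] []]|].
Qed.

Lemma cval_type_of sigma i : cval sigma i = (type_of sigma i == valley).
Proof.
rewrite /cval -low_target_type_of -up_source_type_of.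
by case: (type_of sigma i) => [[[] []]|].
Qed.

Lemma cdrise_type_of sigma i : cdrise sigma i = (type_of sigma i == drise).
Proof.
rewrite /cdrise -up_target_type_of -up_source_type_of.
by case: (type_of sigma i) => [[[] []]|].
Qed.

Lemma cdfall_type_of sigma i : cdfall sigma i = (type_of sigma i == dfall).
Proof.
rewrite /cdfall -low_target_type_of -low_source_type_of.
by case: (type_of sigma i) => [[[] []]|].
Qed.

Lemma fix_type_of sigma i : (i \in Fix sigma) = (type_of sigma i == None).
Proof. by rewrite inE /type_of; case: eqP. Qed.

(** [sigma] maps low sources bijectively to low targets; discarding the double falls from both
    leaves peaks and valleys. *)
Lemma balanced_type_of sigma :
  count_type (type_of sigma) (pred1 valley) predT = count_type (type_of sigma) (pred1 peak) predT.
Proof.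
apply/eqP; rewrite -(eqn_add2r (count_type (type_of sigma) (pred1 dfall) predT)).
rewrite -count_low_target -count_low_source /count_type.
rewrite -(card_imset _ (@perm_inj _ sigma^-1%g)); apply/eqP/eq_card => j.
rewrite -[j in LHS](permK sigma) (mem_imset _ _ (@perm_inj _ sigma^-1%g)) !inE /=.
by rewrite low_target_type_of low_source_type_of permK.
Qed.

Lemma allowed_type_of sigma k : allowed (type_of sigma) k (sigma k).
Proof.
rewrite /allowed up_target_type_of low_target_type_of permK {1}/type_of -val_eqE /=.
by case: ltngtP => //= /val_inj->.
Qed.

Lemma perm_choices sigma k : sigma k \in choices (type_of sigma) k [ffun i => sigma i].
Proof.
apply/choicesP; split=> [|j jk]; first exact: allowed_type_of.
by rewrite ffunE (inj_eq perm_inj); apply: contraTneq jk => ->; rewrite /before ltnn.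
Qed.

(** The source side of a type is read off the arc leaving [k], the target side off the arc arriving
    from its preimage. *)
Lemma type_of_choices (tau : 'I_n -> cycle_type) sigma :
  (forall k, allowed tau k (sigma k)) -> type_of sigma =1 tau.
Proof.
move=> ok k; have srcE i : (up_source (tau i) = (i < sigma i)%N)
              * (low_source (tau i) = (sigma i < i)%N).
  have := ok i; rewrite /allowed; case: (tau i) => [[[] b]|] /=.
  - by move=> /andP[ilt _]; rewrite ilt ltnNge (ltnW ilt).
  - by move=> /andP[ilt _]; rewrite ilt ltnNge (ltnW ilt).
  by move=> /eqP->; rewrite ltnn.
apply: cycle_type_inj; rewrite ?up_source_type_of ?low_source_type_of ?srcE //.
rewrite up_target_type_of; have := ok (sigma^-1%g k); rewrite permKV /allowed.
case tj: (tau (sigma^-1%g k)) => [[[] b]|].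
- by move=> /andP[-> ->].
- move=> /andP[klt]; rewrite ltnNge (ltnW klt) /=.
  by case: (tau k) => [[? []]|].
by move=> /eqP kE; rewrite -{1}kE ltnn kE tj.
Qed.

Lemma eq_choices (tau tau' : 'I_n -> cycle_type) k (f : {ffun 'I_n -> 'I_n}) :
  tau =1 tau' -> choices tau k f = choices tau' k f.
Proof.
move=> tauE; apply/setP => c; rewrite !inE /allowed !tauE; congr (_ && _).
by apply: eq_forallb => j; rewrite /before /rank !tauE.
Qed.

(* f is injective as a value is never reused, hence the sum over f is a sum   *)
(* over permutations.                                                         *)
Lemma sum_type_of (R : nmodType) (tau : 'I_n -> cycle_type) (F : {ffun 'I_n -> 'I_n} -> R) :
  \sum_(sigma : 'S_n | [forall k, type_of sigma k == tau k]) F [ffun i => sigma i]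
  = \sum_(f : {ffun 'I_n -> 'I_n} | [forall k, f k \in choices tau k f]) F f.
Proof.
have f_inj (f : {ffun 'I_n -> 'I_n}) : [forall k, f k \in choices tau k f] -> injectiveb f.
  move=> /forallP okf; apply/injectiveP => i j.
  wlog ij : i j / (rank tau i <= rank tau j)%N => [Wij|] fij.
    by case/orP: (leq_total (rank tau i) (rank tau j)) => [ij|ji]; [|apply/esym]; apply: Wij.
  move: ij; rewrite leq_eqVlt => /orP[/eqP/rank_inj // | ij].
  by have /choicesP[_ /(_ _ ij)] := okf j; rewrite fij eqxx.
rewrite [RHS](reindex_onto (@pval _) (insubd (1%g : 'S_n))) => [|f /f_inj f_injb]; last first.
  exact: insubdK.
apply: eq_big => [sigma | sigma _]; last first.
  by congr F; apply/ffunP => i; rewrite ffunE pvalE.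
have fE : pval sigma = [ffun i => sigma i] by apply/ffunP => i; rewrite ffunE pvalE.
rewrite valKd eqxx andbT fE; apply/forallP/forallP => [tauE k|okf k].
  rewrite -(@eq_choices (type_of sigma)) => [|i]; last exact/eqP.
  by rewrite ffunE perm_choices.
apply/eqP/type_of_choices => i; have := okf i.
by rewrite ffunE => /choicesP[].
Qed.

End PermutationWord.

(** * Statistics read off the free targets *)

Section Statistics.

Variables (n : nat) (sigma : 'S_n).
Implicit Types (j k c : 'I_n).

Let f : {ffun 'I_n -> 'I_n} := [ffun i => sigma i].
Let A k := choices (type_of sigma) k f.

(** A low target is free exactly when its preimage is not yet processed, and low sources are
    processed from left to right. *)
Lemma choices_low k c : (sigma k < k)%N ->
  (c \in A k) = (c < k)%N && (k <= sigma^-1%g c)%N.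
Proof.
move=> k_low.
have allowedE : allowed (type_of sigma) k c = (c < k)%N && (c < sigma^-1%g c)%N.
  have := low_source_type_of sigma k; rewrite k_low -low_target_type_of /allowed.
  by case: (type_of sigma k) => [[[]]|].
have before_k j : before (type_of sigma) j k = (sigma j < j)%N && (j < k)%N.
  by rewrite beforeE !low_source_type_of k_low.
apply/choicesP/andP => [[]|[ck kc]].
  rewrite allowedE => /andP[ck c_low] fresh; split=> //; rewrite leqNgt; apply/negP => sck.
  by have := fresh (sigma^-1%g c); rewrite before_k ffunE permKV c_low sck eqxx => /(_ isT).
split=> [|j]; first by rewrite allowedE ck (leq_trans ck).
rewrite before_k ffunE => /andP[_]; apply: contraTneq => jc.
by rewrite -leqNgt -(permK sigma j) jc.
Qed.

Lemma choices_up k c : (k < sigma k)%N ->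
  (c \in A k) = (k < c)%N && (sigma^-1%g c <= k)%N.
Proof.
move=> k_up.
have allowedE : allowed (type_of sigma) k c = (k < c)%N && (sigma^-1%g c < c)%N.
  have := up_source_type_of sigma k; rewrite k_up -up_target_type_of /allowed.
  by case: (type_of sigma k) => [[[]]|].
have before_k j : before (type_of sigma) j k = (sigma j < j)%N || (k < j)%N.
  by rewrite beforeE !low_source_type_of ltnNge (ltnW k_up).
apply/choicesP/andP => [[]|[kc ck]].
  rewrite allowedE => /andP[kc c_up] fresh; split=> //; rewrite leqNgt; apply/negP => sck.
  by have := fresh (sigma^-1%g c); rewrite before_k ffunE permKV sck eqxx orbT => /(_ isT).
split=> [|j]; first by rewrite allowedE kc (leq_ltn_trans ck).
rewrite before_k ffunE; apply: contraTneq => jc.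
rewrite negb_or -!leqNgt -(permK sigma j) jc ck andbT permKV.
exact: leq_trans ck (ltnW kc).
Qed.

(** A free target between [sigma k] and [k] has its preimage right of [k], which is a crossing; the
    other three identities are obtained likewise. *)
Lemma lcross_above k : (sigma k < k)%N -> lcross k sigma = above (@rightward n) (A k) (sigma k).
Proof.
move=> k_low; rewrite /lcross /above.
rewrite -(card_imset _ (_ : injective (fun c => (sigma k, c, sigma^-1%g c)))); last first.
  by move=> c d [].
apply: eq_card => -[[i j] l]; rewrite inE; apply/and5P/imsetP.
  move=> [ij jk kl /eqP iE /eqP jE]; exists j; rewrite ?iE ?jE ?permK // inE choices_low // permK.
  by rewrite -jE jk ltnW //= /rightward -iE.
move=> [c + [-> -> ->]]; rewrite inE choices_low // permKV !eqxx.
move=> /andP[/andP[ck kc] kc']; split=> //; rewrite ltn_neqAle kc andbT.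
by apply: contraTneq kc' => /val_inj kE; rewrite kE permKV /rightward ltnn.
Qed.

Lemma lnest_below k : (sigma k < k)%N -> lnest k sigma = below (@rightward n) (A k) (sigma k).
Proof.
move=> k_low; rewrite /lnest /below.
rewrite -(card_imset _ (_ : injective (fun c => (c, sigma k, sigma^-1%g c)))); last first.
  by move=> c d [].
apply: eq_card => -[[i j] l]; rewrite inE; apply/and5P/imsetP.
  move=> [ij jk kl /eqP iE /eqP jE]; exists i; rewrite ?iE ?jE ?permK // inE choices_low // permK.
  by rewrite -iE (ltn_trans ij jk) ltnW //= /rightward -jE.
move=> [c + [-> -> ->]]; rewrite inE choices_low // permKV !eqxx.
move=> /andP[/andP[ck kc] kc']; split=> //; rewrite ltn_neqAle kc andbT.
by apply: contraTneq kc' => /val_inj kE; rewrite kE permKV /rightward ltnn.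
Qed.

Lemma leftward_ltn (c d : 'I_n) : (leftward c < leftward d)%N = (d < c)%N.
Proof. by rewrite /leftward; have := ltn_ord c; have := ltn_ord d; lia. Qed.

Lemma ucross_above k : (k < sigma k)%N -> ucross k sigma = above (@leftward n) (A k) (sigma k).
Proof.
move=> k_up; rewrite /ucross /above.
rewrite -(card_imset _ (_ : injective (fun c => (sigma^-1%g c, c, sigma k)))); last first.
  by move=> c d [].
apply: eq_card => -[[i j] l]; rewrite inE; apply/and5P/imsetP.
  move=> [ik kj jl /eqP jE /eqP lE]; exists j; rewrite ?lE ?jE ?permK // inE choices_up // permK.
  by rewrite -jE kj ltnW //= leftward_ltn -lE.
move=> [c + [-> -> ->]]; rewrite inE choices_up // permKV !eqxx leftward_ltn.
move=> /andP[/andP[kc ck] kc']; split=> //; rewrite ltn_neqAle ck andbT.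
by apply: contraTneq kc' => /val_inj kE; rewrite -kE permKV ltnn.
Qed.

Lemma unest_below k : (k < sigma k)%N -> unest k sigma = below (@leftward n) (A k) (sigma k).
Proof.
move=> k_up; rewrite /unest /below.
rewrite -(card_imset _ (_ : injective (fun c => (sigma^-1%g c, sigma k, c)))); last first.
  by move=> c d [].
apply: eq_card => -[[i j] l]; rewrite inE; apply/and5P/imsetP.
  move=> [ik kj jl /eqP jE /eqP lE]; exists l; rewrite ?lE ?jE ?permK // inE choices_up // permK.
  by rewrite -lE (ltn_trans kj jl) ltnW //= leftward_ltn -jE.
move=> [c + [-> -> ->]]; rewrite inE choices_up // permKV !eqxx leftward_ltn.
move=> /andP[/andP[kc ck] kc']; split=> //; rewrite ltn_neqAle ck andbT.
by apply: contraTneq kc' => /val_inj kE; rewrite -kE permKV ltnn.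
Qed.


(** Pigeonhole: the values at the indices left of [k] do not all fit below [sigma k]. *)
Lemma low_not_record k : (sigma k < k)%N -> record sigma k = false.
Proof.
move=> k_low; apply/negP => /forallP rec.
have : (#|sigma @: [set j : 'I_n | (j < k)%N]| <= #|[set j : 'I_n | (j < sigma k)%N]|)%N.
  apply/subset_leq_card/subsetP => _ /imsetP[j + ->]; rewrite !inE => jk.
  by have := rec j; rewrite jk.
rewrite card_imset; last exact: perm_inj.
have lt_sub : [set j : 'I_n | (j < sigma k)%N] \proper [set j : 'I_n | (j < k)%N].
  apply/properP; split; first by apply/subsetP => j; rewrite !inE => /ltn_trans; apply.
  by exists (sigma k); rewrite !inE ?ltnn.
by rewrite leqNgt (proper_card lt_sub).
Qed.

Lemma up_not_antirecord k : (k < sigma k)%N -> antirecord sigma k = false.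
Proof.
move=> k_up; apply/negP => /forallP rec.
have : (#|sigma @: [set j : 'I_n | (k < j)%N]| <= #|[set j : 'I_n | (sigma k < j)%N]|)%N.
  apply/subset_leq_card/subsetP => _ /imsetP[j + ->]; rewrite !inE => jk.
  by have := rec j; rewrite jk.
rewrite card_imset; last exact: perm_inj.
have gt_sub : [set j : 'I_n | (sigma k < j)%N] \proper [set j : 'I_n | (k < j)%N].
  apply/properP; split; first by apply/subsetP => j; rewrite !inE => /(ltn_trans k_up).
  by exists (sigma k); rewrite !inE ?ltnn.
by rewrite leqNgt (proper_card gt_sub).
Qed.

(** A later index with a smaller value is precisely the source of an arc enclosing that of [k]. *)
Lemma low_antirecord k : (sigma k < k)%N -> antirecord sigma k = (lnest k sigma == 0%N).
Proof.
move=> k_low; rewrite /lnest cards_eq0; apply/forallP/eqP => [rec|nest0 j].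
  apply/setP => -[[i j] l]; rewrite !inE; apply/and5P => -[ij jk kl /eqP iE /eqP jE].
  by have := rec l; rewrite kl -iE -jE ltnNge (ltnW ij).
apply/implyP => kj; rewrite ltn_neqAle leqNgt; apply/andP; split.
  by apply: contraTneq kj => /val_inj/perm_inj->; rewrite ltnn.
apply/negP => jk; have := in_set0 (sigma j, sigma k, j).
by rewrite -nest0 inE jk k_low kj !eqxx.
Qed.

Lemma up_record k : (k < sigma k)%N -> record sigma k = (unest k sigma == 0%N).
Proof.
move=> k_up; rewrite /unest cards_eq0; apply/forallP/eqP => [rec|nest0 j].
  apply/setP => -[[i j] l]; rewrite !inE; apply/and5P => -[ik kj jl /eqP jE /eqP lE].
  by have := rec i; rewrite ik -lE -jE ltnNge (ltnW jl).
apply/implyP => jk; rewrite ltn_neqAle leqNgt; apply/andP; split.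
  by apply: contraTneq jk => /val_inj/perm_inj->; rewrite ltnn.
apply/negP => kj; have := in_set0 (j, sigma k, sigma j).
by rewrite -nest0 inE jk k_up kj !eqxx.
Qed.

(** An up arc starting left of the fixed point [k] either ends left of [k] or passes over it. So the
    arcs over [k] number up sources minus up targets on the left, that is, valleys minus peaks. *)
Lemma psnest_level k : sigma k = k -> psnest_at k sigma = level (type_of sigma) k.
Proof.
move=> sk; rewrite /level /psnest_at.
set tau := type_of sigma; pose lt_k := fun j : 'I_n => (j < k)%N.
have k_src : count_type tau up_source lt_k
    = (#|[set j : 'I_n | (j < k)%N && (k < sigma j)%N]| + count_type tau up_target lt_k)%N.
  rewrite /count_type -(cardsID [set j : 'I_n | (k < sigma j)%N]); congr (_ + _)%N.
    apply: eq_card => j; rewrite !inE up_source_type_of -andbA /lt_k.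
    by case: (ltnP j k) => //= jk; apply: andb_idl; apply: ltn_trans.
  rewrite -(card_imset _ (@perm_inj _ sigma)); apply: eq_card => j.
  rewrite -[j](permKV sigma) (mem_imset _ _ (@perm_inj _ sigma)).
  rewrite !inE up_source_type_of up_target_type_of !permKV.
  case: (ltnP (sigma^-1%g j) j) => ij; rewrite ?andbF // !andbT -leqNgt /lt_k.
  have jk : j != k by apply: contraTneq ij => ->; rewrite -{1}sk permK ltnn.
  rewrite leq_eqVlt val_eqE (negPf jk) /=.
  by apply: andb_idr; apply: ltn_trans.
move: k_src; rewrite count_up_source count_up_target /lt_k => k_src.
by rewrite -(addnK (count_type tau (pred1 peak) lt_k) #|_|); lia.
Qed.

(** * Cycles counted by their minima *)

Definition cycle_min k := [forall j, (j \in porbit sigma k) ==> (k <= j)%N].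

Lemma cyc_cycle_min : cyc sigma = #|[set k | cycle_min k]|.
Proof.
rewrite /cyc -(card_in_imset (f := porbit sigma)) => [|i j]; last first.
  rewrite !inE => /forallP imin /forallP jmin ij; apply: val_inj; apply/eqP.
  rewrite eqn_leq; have := imin j; rewrite ij porbit_id implyTb => -> /=.
  by have := jmin i; rewrite -ij porbit_id.
apply: eq_card => C; apply/imsetP/imsetP => -[k _ ->{C}]; last by exists k.
have [m mk m_min] : exists2 m, m \in porbit sigma k & forall j, j \in porbit sigma k -> (m <= j)%N.
  by case: (arg_minnP val (porbit_id sigma k)) => m; exists m.
exists m; last by apply/eqP; rewrite eq_sym eq_porbit_mem.
rewrite inE; apply/forallP => j; apply/implyP => jm; apply: m_min.
by rewrite -(eqP (_ : porbit sigma m == porbit sigma k)) // eq_porbit_mem.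
Qed.

Lemma low_not_cycle_min k : (sigma k < k)%N -> cycle_min k = false.
Proof.
move=> k_low; apply/negP => /forallP/(_ (sigma k)).
by have := mem_porbit sigma 1 k; rewrite expg1 => ->; rewrite leqNgt k_low.
Qed.

Lemma drise_not_cycle_min k : (sigma^-1%g k < k)%N -> cycle_min k = false.
Proof.
move=> k_low; apply/negP => /forallP/(_ (sigma^-1%g k)).
have := mem_porbit sigma 1 (sigma^-1%g k); rewrite expg1 permKV porbit_sym => ->.
by rewrite leqNgt k_low.
Qed.

Lemma fix_cycle_min k : sigma k = k -> cycle_min k.
Proof.
move=> sk; apply/forallP => j; apply/implyP => /porbitP[m ->].
by rewrite permX iter_fix.
Qed.

(** If the cycle closes at [k], its other elements are low sources or lie right of [k]; its minimum
    is not a low source, so it is [k]. Conversely, if [k] is the minimum, the others lie to its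
    right and are already processed. *)
Lemma closes_cycle_min k : type_of sigma k = valley ->
  closes (type_of sigma) k f (sigma k) = cycle_min k.
Proof.
move=> tk; have k_nlow : low_source (type_of sigma k) = false by rewrite tk.
have iterE (i : nat) x : iter i f x = iter i sigma x by apply: eq_iter => y; rewrite ffunE.
apply/connect_iterP/idP => [[m mk mB]|/forallP k_min].
  have orbB j : j \in porbit sigma k -> (j == k) || before (type_of sigma) j k.
    (* The closing path has [m] arcs, so [m + 1] iterations fix [k] and exponents reduce modulo
       [m + 1]. *)
    case/porbitP => a ->; rewrite permX (divn_eq a m.+1) addnC iterD iterM.
    rewrite (iter_fix _ (_ : iter m.+1 sigma k = k)); last by rewrite iterSr -iterE.
    have := ltn_pmod a (ltn0Sn m); case: (a %% m.+1)%N => [|i]; first by rewrite eqxx.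
    by rewrite ltnS iterSr -iterE => /mB->; rewrite orbT.
  case: (arg_minnP val (porbit_id sigma k)) => j jk j_min.
  suff <- : j = k.
    have jE : porbit sigma j = porbit sigma k by apply/eqP; rewrite eq_porbit_mem.
    by apply/forallP => i; apply/implyP; rewrite jE; apply: j_min.
  have := orbB j jk; rewrite beforeE k_nlow low_source_type_of.
  case/predU1P => // /orP[j_low|kj]; last by have := j_min _ (porbit_id sigma k); rewrite leqNgt kj.
  suff /j_min : sigma j \in porbit sigma k by rewrite leqNgt j_low.
  have jE : porbit sigma j = porbit sigma k by apply/eqP; rewrite eq_porbit_mem.
  by rewrite -jE; have := mem_porbit sigma 1 j; rewrite expg1.
pose p (i : nat) := iter i.+1 sigma k == k.
have p_ex : exists i, p i.
  exists #|porbit sigma k|.-1; rewrite /p prednK ?iter_porbit //.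
  by rewrite lt0n card_porbit_neq0.
case: (ex_minnP p_ex) => m /eqP mk m_min; exists m; first by rewrite iterE -iterSr.
move=> i im; rewrite iterE -iterSr beforeE k_nlow orbC ltn_neqAle.
have := k_min (iter i.+1 sigma k); rewrite -permX mem_porbit /= permX => ->.
rewrite andbT eq_sym val_eqE; apply/orP; left.
by apply: contraL im => /m_min; rewrite -leqNgt.
Qed.

End Statistics.

(** * From permutations to Motzkin paths *)

Section Assembly.

Variables (R : comNzRingType) (x1 x2 y1 y2 u1 u2 v2 : R).
Variables (pp1 pp2 pm1 pm2 qp2 qm1 qm2 : R) (s lambda : R) (w : nat -> R).

Lemma eq_choice_weight n (tau tau' : 'I_n -> cycle_type) k f c : tau =1 tau' ->
  choice_weight x1 x2 y1 y2 u1 u2 v2 pp1 pp2 pm1 pm2 qp2 qm1 qm2 s lambda w tau k f c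
  = choice_weight x1 x2 y1 y2 u1 u2 v2 pp1 pp2 pm1 pm2 qp2 qm1 qm2 s lambda w tau' k f c.
Proof.
move=> tauE; rewrite /choice_weight -tauE (eq_choices _ _ tauE).
have -> : level tau k = level tau' k.
  by congr (_ - _)%N; apply: eq_card => j; rewrite !inE tauE.
have -> // : closes tau k f c = closes tau' k f c.
by apply: eq_connect => a b; rewrite /= /before /rank !tauE.
Qed.

Lemma expr_card_prod (I : finType) (P : pred I) (x : R) :
  x ^+ #|[set i | P i]| = \prod_i x ^+ P i.
Proof.
rewrite prodrXr -sum1_card big_mkcond; congr (_ ^+ _).
by apply: eq_bigr => i _; rewrite inE; case: (P i).
Qed.

Lemma expr_sum_prod (I : finType) (P : pred I) (F : I -> nat) (x : R) :
  x ^+ (\sum_(i | P i) F i) = \prod_i x ^+ (if P i then F i else 0).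
Proof. by rewrite prodrXr big_mkcond. Qed.

(** Every statistic is a sum of contributions of single indices, [cyc] being carried by the cycle
    minima, so the two sides are compared index by index. At a valley, record or not, the mark is
    [y1]. *)
Lemma weight_prod n (sigma : 'S_n) :
     x1 ^+ eareccpeak sigma * x2 ^+ eareccdfall sigma
   * y1 ^+ ereccval sigma * y2 ^+ ereccdrise sigma
   * u1 ^+ nrcpeak sigma * u2 ^+ nrcdfall sigma
   * y1 ^+ nrcval sigma * v2 ^+ nrcdrise sigma
   * (\prod_(i in Fix sigma) w (psnest_at i sigma))
   * pp1 ^+ ucrosscval sigma * pp2 ^+ ucrosscdrise sigma
   * pm1 ^+ lcrosscpeak sigma * pm2 ^+ lcrosscdfall sigma
   * pp1 ^+ unestcval sigma * qp2 ^+ unestcdrise sigma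
   * qm1 ^+ lnestcpeak sigma * qm2 ^+ lnestcdfall sigma
   * s ^+ psnest sigma * lambda ^+ cyc sigma
  = \prod_k choice_weight x1 x2 y1 y2 u1 u2 v2 pp1 pp2 pm1 pm2 qp2 qm1 qm2 s lambda w
      (type_of sigma) k [ffun i => sigma i] (sigma k).
Proof.
rewrite cyc_cycle_min !expr_card_prod !expr_sum_prod [\prod_(i in _) _]big_mkcond.
rewrite -!big_split /=; apply: eq_bigr => k _; rewrite fix_type_of.
rewrite !cpeak_type_of !cval_type_of !cdrise_type_of !cdfall_type_of.
rewrite /exclusive_antirecord /exclusive_record /neither_record /choice_weight.
case tk: (type_of sigma k) => [[[] []]|].
- have k_up : (k < sigma k)%N by rewrite -up_source_type_of tk.
  have k_min : cycle_min sigma k = false.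
    by apply: drise_not_cycle_min; rewrite -up_target_type_of tk.
  rewrite /= up_not_antirecord // up_record // k_min ucross_above // unest_below //.
  rewrite /arc_weight; case: eqP => _ /=; ring.
- have k_up : (k < sigma k)%N by rewrite -up_source_type_of tk.
  rewrite /= up_not_antirecord // closes_cycle_min // ucross_above // unest_below // exprD.
  case: (record sigma k); case: (cycle_min sigma k) => /=; ring.
- have k_low : (sigma k < k)%N by rewrite -low_source_type_of tk.
  rewrite /= low_not_record // low_antirecord // low_not_cycle_min //.
  rewrite lcross_above // lnest_below //.
  rewrite /arc_weight; case: eqP => _ /=; ring.
- have k_low : (sigma k < k)%N by rewrite -low_source_type_of tk.
  rewrite /= low_not_record // low_antirecord // low_not_cycle_min //.
  rewrite lcross_above // lnest_below //.
  rewrite /arc_weight; case: eqP => _ /=; ring.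
have k_fix : sigma k = k by apply/eqP; have := fix_type_of sigma k; rewrite tk eqxx inE.
rewrite /= psnest_level // fix_cycle_min //=; ring.
Qed.

Lemma count_take n (ts : n.-tuple cycle_type) (P : pred cycle_type) m : (m <= n)%N ->
  count_type (tnth ts) P (fun j => j < m)%N = count P (take m ts).
Proof.
move=> mn; rewrite -sum1_count (big_nth None) size_takel ?size_tuple // big_mkord.
rewrite (big_ord_widen_cond n (fun i => P (nth None (take m ts) i)) (fun=> 1%N)) //.
rewrite /count_type -sum1_card.
apply: eq_bigl => j; rewrite inE andbC; case: (ltnP j m) => jm; rewrite ?andbF ?andbT //.
by rewrite nth_take // (tnth_nth None).
Qed.

Lemma Qhat_motzkin n :
  Qhat x1 x2 y1 y2 u1 u2 y1 v2 pp1 pp2 pm1 pm2 pp1 qp2 qm1 qm2 s lambda w n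
  = let step := step_sum x1 x2 y1 y2 u1 u2 v2 pp1 pp2 pm1 pm2 qp2 qm1 qm2 s lambda w in
    motzkin (step valley) (fun h => step dfall h + step drise h + step None h) (step peak) 0 n 0.
Proof.
cbv zeta; rewrite -motzkin_words; last by rewrite /= /arc_sum big_ord0.
rewrite /Qhat; under eq_bigr => sigma _ do rewrite weight_prod.
(* Group the permutations by their word of cycle types; only balanced words occur. *)
rewrite (partition_big (fun sigma : 'S_n => [tuple type_of sigma i | i < n])
  (fun ts => (0 + count_mem valley ts == count_mem peak ts)%N)) /=; last first.
  move=> sigma _; apply/eqP; set ts := [tuple type_of sigma i | i < n].
  have tsE i : tnth ts i = type_of sigma i by rewrite tnth_mktuple.
  have countE P : count P ts = count_type (type_of sigma) P predT.
    rewrite -[X in count P X]take_size size_tuple -count_take //; apply: eq_card => j.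
    by rewrite !inE tsE ltn_ord.
  by rewrite add0n !countE balanced_type_of.
apply: eq_bigr => ts /eqP ts_bal.
transitivity (\sum_(sigma : 'S_n | [forall k, type_of sigma k == tnth ts k])
    \prod_k choice_weight x1 x2 y1 y2 u1 u2 v2 pp1 pp2 pm1 pm2 qp2 qm1 qm2 s lambda w
      (tnth ts) k [ffun i => sigma i] ([ffun i => sigma i] k)).
  apply: eq_big => [sigma|sigma /eqP sigma_ts].
    apply/eqP/forallP => [<- k|tE]; first by rewrite tnth_mktuple.
    by apply: eq_from_tnth => k; rewrite tnth_mktuple; apply/eqP.
  apply: eq_bigr => k _; rewrite ffunE; apply: eq_choice_weight => i.
  by rewrite -sigma_ts tnth_mktuple.
rewrite (sum_type_of (tnth ts) (fun f => \prod_k choice_weight x1 x2 y1 y2 u1 u2 v2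
  pp1 pp2 pm1 pm2 qp2 qm1 qm2 s lambda w (tnth ts) k f (f k))).
have countE P : count_type (tnth ts) P predT = count P ts.
  by rewrite -[X in count P X]take_size size_tuple -count_take //;
    apply: eq_card => j; rewrite !inE ltn_ord.
rewrite sum_fixed_word; last by rewrite !countE -ts_bal.
apply: eq_bigr => k _; rewrite (tnth_nth None); congr step_sum.
by rewrite /level /height add0n !count_take // ltnW.
Qed.

End Assembly.

Theorem theorem3p2 (R : comNzRingType) (x1 x2 y1 y2 u1 u2 v1 v2 : R)
    (pp1 pp2 pm1 pm2 qp1 qp2 qm1 qm2 : R) (s lambda : R) (w : nat -> R)
    (hv1 : v1 = y1) (hqp1 : qp1 = pp1) :
  eq_Jfraction
    (Qhat x1 x2 y1 y2 u1 u2 v1 v2 pp1 pp2 pm1 pm2 qp1 qp2 qm1 qm2 s lambda w)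
    (fun n : nat =>
       if n == 0%N then lambda * w 0%N
       else (pm2 ^+ n.-1 * x2 + qm2 * pqint pm2 qm2 n.-1 * u2)
          + (pp2 ^+ n.-1 * y2 + qp2 * pqint pp2 qp2 n.-1 * v2)
          + lambda * s ^+ n * w n)
    (fun n : nat =>
       (lambda + (n.-1)%:R)
       * (pm1 ^+ n.-1 * x1 + qm1 * pqint pm1 qm1 n.-1 * u1)
       * pp1 ^+ n.-1 * y1).
Proof.
move=> n; exists n.+1 => d nd; rewrite hv1 hqp1 Qhat_motzkin.
apply: motzkin_jconvergent nd => [[|h]|h] /=; rewrite ?arc_sumS //.
  (* At height 0 the arc sums are empty, so only the fixed-point term is left in the level
     weight. *)
  by rewrite /arc_sum !big_ord0 !add0r mulr1.
by ring.
Qed.
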